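(* Let $d\geq 2$, $\rho\in(0,1)$, and let $0<a_\rho<b_\rho<1$, $\varepsilon_\rho>0$ be constants having property (P) described in the context. Then for $s>d-\varepsilon_\rho$, any unbounded Borel set $A\subseteq\mathbb R^d$ that is well-distributed with $s$-density at least $(1-\rho)$ and growth rate at most $b_\rho/a_\rho$ contains all sufficiently large distances; i.e., there exists $M=M(A)>0$ with $\Delta(A)\supseteq[M,\infty)$.
   Context: $\Delta(E)=\{|x-y|:x,y\in E\}$ is the distance set ($|\cdot|$ Euclidean norm). $\ell(Q)$ is the side-length of a cube $Q$; dyadic cubes are closed. $\mathbb H^s$ is $s$-dimensional Hausdorff measure; the $s$-dimensional dyadic Hausdorff content is $\mathcal H^s_\infty(E)=\inf\{\sum_i\ell(Q_i)^s:E\subseteq\bigcup_{i=1}^\infty Q_i,\ Q_i\text{ closed dyadic cubes}\}$, $s\in(0,d]$. For $E\subseteq[0,1]^d$, $\mathcal D_\rho(E;s)$ denotes the collection of dyadic cubes $Q\subseteq[0,1]^d$ with $\mathcal H^s_\infty(E\cap Q)>(1-\rho)\ell(Q)^s$. Property (P) (for given $d,\rho$): the constants $a_\rho,b_\rho,\varepsilon_\rho$ depend only on $d$ and $\rho$, and for every Borel set $E\subseteq[0,1]^d$ with $\mathbb H^s(E)>0$ for some $s>d-\varepsilon_\rho$, one has $\Delta(E)\supseteq\bigcup\{\ell(Q)[a_\rho,b_\rho]:Q\in\mathcal D_\rho(E;s)\}$. (Such constants exist for all sufficiently small $\rho$.) Normalized truncations: for an unbounded Borel set $A\subseteq\mathbb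 R^d$, $x\in\mathbb R^d$, $R\ge1$, set $Q(x;R)=x+[0,R]^d$ and $A_R(x)=\{(y-x)/R : y\in A\cap Q(x;R)\}\subseteq[0,1]^d$. High-density scales: $\mathscr V(\rho,s;A)$ is the set of all numbers $R\ell\in(0,\infty)$ such that $R\ge1$ and, for some $x\in\mathbb R^d$, $\mathbb H^s(A_R(x))>0$ and $\ell=\ell(Q)$ for some $Q\in\mathcal D_\rho(A_R(x);s)$. $A$ is well-distributed with $s$-density at least $(1-\rho)$ and growth rate at most $C_0>1$ if $\mathscr V(\rho,s;A)$ contains an infinite sequence $\{v_n:n\ge1\}$ with $v_n\nearrow\infty$ and $v_{n+1}/v_n\le C_0$ for all sufficiently large $n$. *)

(* Defs.v *)
From HB Require Import structures.
From mathcomp Require Import all_boot all_order all_algebra.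
From mathcomp Require Import all_classical all_reals all_analysis.

Set Implicit Arguments.
Unset Strict Implicit.
Unset Printing Implicit Defensive.

Import Order.TTheory GRing.Theory Num.Theory.
Import numFieldNormedType.Exports.

Local Open Scope classical_set_scope.
Local Open Scope ring_scope.

(* The library norm on ['rV[R]_d] is the sup norm, hence this one. *)
Definition enorm (R : realType) (d : nat) (x : 'rV[R]_d) : R :=
  Num.sqrt (\sum_(i < d) x 0 i ^+ 2).

Definition distance_set (R : realType) (d : nat) (E : set 'rV[R]_d) : set R :=
  [set enorm (p.1 - p.2) | p in E `*` E].

Definition unbounded (R : realType) (d : nat) (A : set 'rV[R]_d) : Prop :=
  ~ exists M : R, forall x, A x -> enorm x <= M.

(* [open] is the product topology of ['rV[R]_d], i.e. the Euclidean one. *)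
Definition borel (R : realType) (d : nat) (E : set 'rV[R]_d) : Prop :=
  <<s [set U : set 'rV[R]_d | open U] >> E.

Definition cube (R : realType) (d : nat) (x : 'rV[R]_d) (r : R) :
    set 'rV[R]_d :=
  [set y | forall i, x 0 i <= y 0 i <= x 0 i + r].

Definition unit_cube (R : realType) (d : nat) : set 'rV[R]_d := cube 0 1.

(* [(k, m)] encodes the closed cube of side [2 ^ k] and lowest corner
   [2 ^ k * m], with [k] and the entries of [m] arbitrary integers. *)
Definition dyadic (d : nat) : Type := (int * 'rV[int]_d)%type.

Definition side (R : realType) (d : nat) (Q : dyadic d) : R := 2 ^ Q.1.
Arguments side R {d} Q.

Definition dyadic_cube (R : realType) (d : nat) (Q : dyadic d) :
    set 'rV[R]_d :=
  cube (\row_i (side R Q * (Q.2 0 i)%:~R)) (side R Q).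
Arguments dyadic_cube R {d} Q.

Definition dyadic_content (R : realType) (d : nat) (s : R)
    (E : set 'rV[R]_d) : \bar R :=
  ereal_inf [set (\sum_(0 <= i <oo) (side R (Q i) `^ s)%:E)%E
            | Q in [set Q : nat -> dyadic d |
                     E `<=` \bigcup_i dyadic_cube R (Q i)]].

(* The [maxe] makes the diameter of the empty set 0. *)
Definition diam (R : realType) (d : nat) (U : set 'rV[R]_d) : \bar R :=
  maxe 0%E (ereal_sup [set t%:E | t in distance_set U]).

Definition hausdorff_delta (R : realType) (d : nat) (s delta : R)
    (E : set 'rV[R]_d) : \bar R :=
  ereal_inf [set (\sum_(0 <= i <oo) poweR (diam (U i)) s)%E
            | U in [set U : nat -> set 'rV[R]_d |
                     E `<=` \bigcup_i U i /\
                     forall i, (diam (U i) <= delta%:E)%E]].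

(* No normalizing factor: only the positivity of this measure is used. *)
Definition hausdorff_measure (R : realType) (d : nat) (s : R)
    (E : set 'rV[R]_d) : \bar R :=
  ereal_sup [set hausdorff_delta s delta E | delta in [set delta | 0 < delta]].

Definition dense_cubes (R : realType) (d : nat) (rho s : R)
    (E : set 'rV[R]_d) : set (dyadic d) :=
  [set Q | dyadic_cube R Q `<=` @unit_cube R d /\
     (((1 - rho) * side R Q `^ s)%:E
        < dyadic_content s (E `&` dyadic_cube R Q))%E].

(* The dyadic content is only defined for exponents in (0, d], which is
   therefore the range of s. *)
Definition propertyP (R : realType) (d : nat) (rho a b eps : R) : Prop :=
  forall (E : set 'rV[R]_d) (s : R),
    borel E -> E `<=` @unit_cube R d ->
    0 < s <= d%:R -> d%:R - eps < s ->
    (0 < hausdorff_measure s E)%E ->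
    \bigcup_(Q in dense_cubes rho s E)
       [set side R Q * t | t in `[a, b]%classic] `<=` distance_set E.

Definition truncation (R : realType) (d : nat) (A : set 'rV[R]_d)
    (x : 'rV[R]_d) (r : R) : set 'rV[R]_d :=
  [set r^-1 *: (y - x) | y in A `&` cube x r].

Definition high_density_scales (R : realType) (d : nat) (rho s : R)
    (A : set 'rV[R]_d) : set R :=
  [set v | exists (r : R) (x : 'rV[R]_d) (Q : dyadic d),
     [/\ 1 <= r, (0 < hausdorff_measure s (truncation A x r))%E,
         dense_cubes rho s (truncation A x r) Q & v = r * side R Q]].

Definition well_distributed (R : realType) (d : nat) (rho s C0 : R)
    (A : set 'rV[R]_d) : Prop :=
  exists v : nat -> R,
    [/\ forall n, high_density_scales rho s A (v n),
        nondecreasing_seq v,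
        v @ \oo --> +oo &
        \forall n \near \oo, v n.+1 / v n <= C0].

(* Main.v *)
Require Import Defs.
From HB Require Import structures.
From mathcomp Require Import all_boot all_order all_algebra.
From mathcomp Require Import all_classical all_reals all_analysis.
Import Order.TTheory GRing.Theory Num.Theory.
Import numFieldNormedType.Exports.
Local Open Scope classical_set_scope.
Local Open Scope ring_scope.

(** Why the theorem is true. Property (P) only speaks of subsets of the unit
    cube, but distances scale: if [v = r * side R Q] is a high-density scale of
    [A], witnessed by a dense cube [Q] of the truncation of [A] to a cube of
    side [r], then (P) puts the interval [side R Q * [a, b]] in the distance
    set of the truncation, and undoing the normalization puts [v * [a, b]] in
    the distance set of [A] ([high_density_scale_distances]). For this, the
    truncation has to be a Borel subset of the unit cube
    ([borel_truncation], [truncation_sub_unit_cube]).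

    A growth rate at most [b / a] says exactly that
    [a * v (n + 1) <= b * v n] for large [n]: each interval
    [[a * v n, b * v n]] starts no later than the previous one ends. As [v] tends
    to infinity, these intervals leave no gap beyond the first of them
    ([itv_chain_cover]), so that [M = a * v N] works, where the growth bound
    holds from the rank [N] on. *)

Lemma closed_borel (R : realType) (d : nat) (F : set 'rV[R]_d) :
  closed F -> borel F.
Proof.
move=> cF; rewrite -(setCK F) -setTD.
apply: (sigma_algebraCD (G := [set U : set 'rV[R]_d | open U])).
by apply: sub_sigma_algebra; exact: closed_openC.
Qed.

Lemma borelI (R : realType) (d : nat) (E F : set 'rV[R]_d) :
  borel E -> borel F -> borel (E `&` F).
Proof.
exact: (@measurableI _ (g_sigma_algebraType [set U : set 'rV[R]_d | open U])).
Qed.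

(** The sets with Borel preimage form a sigma-algebra, which contains the open
    sets because [f] is continuous. *)
Lemma borel_preimage (R : realType) (d : nat) (f : 'rV[R]_d -> 'rV[R]_d)
    (E : set 'rV[R]_d) :
  continuous f -> borel E -> borel (f @^-1` E).
Proof.
move=> cf bE; rewrite -[f @^-1` E]setTI; move: E bE.
apply: smallest_sub.
  exact: (sigma_algebra_image f (smallest_sigma_algebra setT _)).
move=> U oU; rewrite /image_set_system /= setTI.
by apply: sub_sigma_algebra; apply: open_comp => // z _; exact: cf.
Qed.

Lemma closed_cube (R : realType) (d : nat) (x : 'rV[R]_d) (r : R) :
  closed (cube x r).
Proof.
have -> : cube x r = \bigcap_(i in [set: 'I_d])
    (fun y : 'rV[R]_d => y 0 i) @^-1` `[x 0 i, x 0 i + r]%classic.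
  apply/seteqP; split=> y /= h i; first by rewrite /= in_itv /=.
  by move: (h i I); rewrite /= in_itv.
apply: closed_bigI => i _; apply: preimage_closed; last exact: itv_closed.
by move=> y _; exact: coord_continuous.
Qed.

(** A truncation is defined as a direct image, under which Borel sets are
    awkward; the normalization being invertible, it is also a preimage. *)
Lemma truncation_preimage (R : realType) (d : nat) (A : set 'rV[R]_d)
    (x : 'rV[R]_d) (r : R) :
  r != 0 ->
  truncation A x r = (fun z : 'rV[R]_d => x + r *: z) @^-1` (A `&` cube x r).
Proof.
move=> r0; apply/seteqP; split=> [_ [y Ay <-]|z Az] /=.
  by rewrite scalerA divff // scale1r addrC subrK.
by exists (x + r *: z) => //; rewrite addrC addKr scalerA mulVf // scale1r.
Qed.

Lemma borel_truncation (R : realType) (d : nat) (A : set 'rV[R]_d)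
    (x : 'rV[R]_d) (r : R) :
  r != 0 -> borel A -> borel (truncation A x r).
Proof.
move=> r0 bA; rewrite truncation_preimage //; apply: borel_preimage.
  move=> z; apply: continuousD; first exact: cst_continuous.
  exact: (@scaler_continuous R [the normedModType R of 'rV[R]_d] r).
by apply: borelI => //; apply: closed_borel; exact: closed_cube.
Qed.

Lemma truncation_sub_unit_cube (R : realType) (d : nat) (A : set 'rV[R]_d)
    (x : 'rV[R]_d) (r : R) :
  0 < r -> truncation A x r `<=` @unit_cube R d.
Proof.
move=> r0 _ [y [_ cy] <-] i; rewrite !mxE add0r.
have /andP[xy yx] := cy i.
by rewrite ler_pdivlMl // ler_pdivrMl // mulr0 mulr1 subr_ge0 xy lerBlDl.
Qed.

Lemma enormZ (R : realType) (d : nat) (c : R) (x : 'rV[R]_d) :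
  0 <= c -> enorm (c *: x) = c * enorm x.
Proof.
move=> c0; rewrite /enorm -[in RHS](ger0_norm c0) -sqrtr_sqr.
rewrite -sqrtrM ?sqr_ge0 // mulr_sumr; congr Num.sqrt.
by apply: eq_bigr => i _; rewrite !mxE exprMn.
Qed.

Lemma distance_set_truncation (R : realType) (d : nat) (A : set 'rV[R]_d)
    (x : 'rV[R]_d) (r t : R) :
  0 < r -> distance_set (truncation A x r) t -> distance_set A (r * t).
Proof.
move=> r0 [_ /= [[y [Ay _] <-] [z [Az _] <-]] <-].
exists (y, z) => //=; rewrite -scalerBr enormZ; last by rewrite invr_ge0 ltW.
by rewrite mulVKf ?gt_eqF // opprB addrA subrK.
Qed.

Lemma high_density_scale_gt0 (R : realType) (d : nat) (rho s : R)
    (A : set 'rV[R]_d) (v : R) :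
  high_density_scales rho s A v -> 0 < v.
Proof.
move=> [r [x [Q [r1 _ _ ->]]]].
by apply: mulr_gt0; [exact: lt_le_trans r1|exact: exprz_gt0].
Qed.

(** The rescaling argument: [t / v] lies in [[a, b]], so (P) gives the
    distance [side R Q * (t / v)] in the truncation, and multiplying it by [r]
    gives [t] in [A]. *)
Lemma high_density_scale_distances (R : realType) (d : nat)
    (rho a b eps s : R) (A : set 'rV[R]_d) (v t : R) :
  propertyP d rho a b eps -> 0 < s <= d%:R -> d%:R - eps < s ->
  borel A -> high_density_scales rho s A v ->
  a * v <= t <= b * v -> distance_set A t.
Proof.
move=> hP hs hseps bA hv; have v0 := high_density_scale_gt0 _ _ _ _ _ _ hv.
case: hv => r [x [Q [r1 hpos hQ vE]]] /andP[avt tbv].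
have r0 : 0 < r by exact: lt_le_trans r1.
have -> : t = r * (side R Q * (t / v)).
  by rewrite mulrA -vE mulrC divfK // gt_eqF.
apply: distance_set_truncation => //.
have bE : borel (truncation A x r) by apply: borel_truncation; rewrite ?gt_eqF.
have sE := truncation_sub_unit_cube _ _ A x r r0.
apply: (hP _ s bE sE hs hseps hpos).
exists Q => //; exists (t / v) => //=.
by rewrite in_itv /= ler_pdivlMr // ler_pdivrMr // avt.
Qed.

(** Take the first rank from [N] on at which [b * v n] reaches [t]. At [N] the
    lower bound is the assumption on [t]; later, [t] exceeds the previous
    [b * v n], hence the current left endpoint. *)
Lemma itv_chain_cover (R : realType) (a b : R) (v : nat -> R) (N : nat) :
  0 < b -> v @ \oo --> +oo ->
  (forall n, (N <= n)%N -> a * v n.+1 <= b * v n) ->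
  forall t, a * v N <= t -> exists n, a * v n <= t <= b * v n.
Proof.
move=> b0 vy chain t Nt.
have [n0 Nn0 tn0] : exists2 n, (N <= n)%N & t <= b * v n.
  have /cvgryPge/(_ (t / b)) [m _ hm] := vy.
  exists (maxn N m); first exact: leq_maxl.
  by rewrite -ler_pdivrMl // mulrC; apply: hm; exact: leq_maxr.
elim: n0 Nn0 tn0 => [|n IHn].
  by rewrite leqn0 => /eqP N0 tn; exists 0%N; rewrite -{1}N0 Nt.
rewrite leq_eqVlt => /predU1P[<- tn|Nn tn]; first by exists N; rewrite Nt.
have [/IHn|/ltW bt] := leP t (b * v n); first by apply.
by exists n.+1; rewrite tn (le_trans (chain _ _)).
Qed.

Theorem theorem1p4 (R : realType) (d : nat) (rho a b eps : R)
  (hd : (2 <= d)%N) (hrho : 0 < rho < 1)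
  (ha : 0 < a) (hab : a < b) (hb : b < 1) (heps : 0 < eps)
  (hP : propertyP d rho a b eps)
  (s : R) (hs : 0 < s <= d%:R) (hseps : d%:R - eps < s)
  (A : set 'rV[R]_d) (hAunb : unbounded A) (hAborel : borel A)
  (hA : well_distributed rho s (b / a) A) :
  exists M : R, 0 < M /\ [set t : R | M <= t] `<=` distance_set A.
Proof.
case: hA => v [hv _ vy [N _ growth]].
have v0 n : 0 < v n by exact: high_density_scale_gt0 (hv n).
exists (a * v N); split; first by rewrite mulr_gt0.
move=> t /= Nt.
have [n] : exists n, a * v n <= t <= b * v n.
  apply: (@itv_chain_cover _ a b v N) => // [|n Nn]; first exact: lt_trans hab.
  by have := growth n Nn; rewrite /= ler_pdivrMr // mulrAC ler_pdivlMr // mulrC.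
apply: (high_density_scale_distances _ _ _ _ _ _ _ _ _ _ hP hs hseps hAborel).
exact: hv.
Qed.
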